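(* Consider a semi-simple MPU with periodic boundary conditions, i.e. a tensor $A$ such that, with boundary operator $b=\mathbb 1$, the operators $U_N$ are unitary for all $N>1$ and the representation $(A,b=\mathbb 1)$ is semi-simple. Then, after blocking a finite number of times, the MPU factorizes: there exist a unitary $V$ on the (blocked) physical space and $\theta\in\mathbb R$ such that, for all $N$ (number of blocked sites), $$U_N=e^{i\theta N}\,V^{\otimes N}.$$
   Context: Fix a physical dimension $d$ and a bond dimension $D$. A tensor $A$ is a family of matrices $A^{ij}\in\mathbb M_D(\mathbb C)$, $i,j\in\{1,\dots,d\}$ ($i$ = physical output, $j$ = physical input). With boundary operator $b\in\mathbb M_D(\mathbb C)$ it defines $$U_N=\sum_{i,j}\mathrm{Tr}\big(bA^{i_1j_1}\cdots A^{i_Nj_N}\big)|i_1\dots i_N\rangle\langle j_1\dots j_N|$$ on $(\mathbb C^d)^{\otimes N}$; periodic boundary conditions mean $b=\mathbb 1$. Let $\sigma_1,\dots,\sigma_{d^2-1}$ be Hermitian traceless $d\times d$ matrices with $\mathrm{Tr}(\sigma_\alpha\sigma_\beta)=\delta_{\alpha\beta}$. Define operators on $\mathbb C^D\otimes\mathbb C^D$ by $$E\equiv S_0=\frac1d\sum_{i,j}\overline{A^{ij}}\otimes A^{ij},\qquad S_\alpha=\sum_{i,j,j'}(\sigma_\alpha)_{jj'}\,\overline{A^{ij'}}\otimes A^{ij}\ (\alpha\ge1),$$ where the bar denotes entrywise complex conjugation, and $\mathcal A=\mathrm{Span}\{S_\alpha\}_{\alpha=0}^{d^2-1}$ (complex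 span). The representation $(A,b)$ is semi-simple if $\mathcal A=\bigoplus_i\mathcal A_i$ with each $\mathcal A_i$ irreducible; i.e. up to a similarity transformation over $\mathbb C^D\otimes\mathbb C^D$ all elements of $\mathcal A$ are simultaneously block diagonal and, for each $i$, the set $\mathcal A_i$ of $i$-th blocks has no nontrivial common invariant subspace (blocks for different $i$ need not be independent of each other). Blocking $q$ times means replacing $A$ by the tensor with physical dimension $d^q$ and the same bond dimension with matrices $A^{i_1j_1}\cdots A^{i_qj_q}$ indexed by the pairs $((i_1,\dots,i_q),(j_1,\dots,j_q))$, so that one blocked site consists of $q$ original sites. *)

(* Defs.v *)
(* The field of complex numbers is R[i], for an arbitrary R : realType. *)
From HB Require Import structures.
From mathcomp Require Import all_boot all_order all_algebra.
From mathcomp Require Import sesquilinear spectral.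
From mathcomp Require Import all_classical all_reals all_analysis.
From mathcomp Require Import complex mxtens.

Set Implicit Arguments.
Unset Strict Implicit.
Unset Printing Implicit Defensive.

Import Order.TTheory GRing.Theory Num.Theory.
Local Open Scope ring_scope.
Local Open Scope complex_scope.

(* Multi-indices (i_1, ..., i_N) over 'I_d, i.e. the computational basis of
   (C^d)^{\otimes N}, are enumerated by the ordinals below [hdim d N] = d ^ N,
   through [enum_val]; [site x k] is the entry of the multi-index x at k. *)
Definition hdim (d N : nat) : nat := #|{: N.-tuple 'I_d}|.

Lemma hdimE d N : hdim d N = (d ^ N)%N.
Proof. by rewrite /hdim card_tuple card_ord. Qed.

Definition site d N (x : 'I_(hdim d N)) (k : 'I_N) : 'I_d :=
  tnth (enum_val x) k.

Definition tensor (R : realType) (d D : nat) : Type :=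
  'I_d -> 'I_d -> 'M[R[i]]_D.

Section MPU.
Variable R : realType.
Local Notation C := (R[i]).

(* The products of matrices below are ordered by increasing site. *)
Definition mpo d D (A : tensor R d D) (b : 'M[C]_D) (N : nat) :
    'M[C]_(hdim d N) :=
  \matrix_(x, y)
    \tr (b *m \big[mulmx/1%:M]_(k < N) A (site x k) (site y k)).

Definition block d D (q : nat) (A : tensor R d D) : tensor R (hdim d q) D :=
  fun x y => \big[mulmx/1%:M]_(k < q) A (site x k) (site y k).

Definition tensor_power d (V : 'M[C]_d) (N : nat) : 'M[C]_(hdim d N) :=
  \matrix_(x, y) \prod_(k < N) V (site x k) (site y k).

Definition expi (t : R) : C := cos t +i* sin t.

Definition hermitian_traceless_basis d (sigma : 'I_(d ^ 2 - 1) -> 'M[C]_d) :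
    Prop :=
  [/\ forall a, sigma a \is hermsymmx,
      forall a, \tr (sigma a) = 0
    & forall a a', \tr (sigma a *m sigma a') = (a == a')%:R].

Definition conjmat m n (M : 'M[C]_(m, n)) : 'M[C]_(m, n) := map_mx Num.conj M.

Definition S_zero d D (A : tensor R d D) : 'M[C]_(D * D) :=
  d%:R^-1 *: \sum_i \sum_j (conjmat (A i j) *t A i j).

Definition S_sigma d D (A : tensor R d D) (s : 'M[C]_d) : 'M[C]_(D * D) :=
  \sum_i \sum_j \sum_j' s j j' *: (conjmat (A i j') *t A i j).

Definition S_span d D (sigma : 'I_(d ^ 2 - 1) -> 'M[C]_d) (A : tensor R d D) :
    {vspace 'M[C]_(D * D)} :=
  <<S_zero A :: [seq S_sigma A (sigma a) | a : 'I_(d ^ 2 - 1)]>>%VS.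

(* Invariance is under the action of matrices on column vectors. *)
Definition irreducible_set p (M : 'M[C]_p -> Prop) : Prop :=
  (0 < p)%N /\
  forall W : {vspace 'cV[C]_p},
    (forall Y v, M Y -> v \in W -> Y *m v \in W) -> W = 0%VS \/ W = fullv.

(* [B i X] is the i-th diagonal block of X after the change of basis, whose
   mutually inverse matrices P and Q are typed as rectangular only because the
   equality of \sum_i p i and n is not definitional.  The blocks of different
   index are allowed to depend on each other. *)
Definition semisimple_space n (S : {vspace 'M[C]_n}) : Prop :=
  exists (m : nat) (p : 'I_m -> nat)
         (P : 'M[C]_(\sum_i p i, n)) (Q : 'M[C]_(n, \sum_i p i))
         (B : forall i, 'M[C]_n -> 'M[C]_(p i)),
    [/\ P *m Q = 1%:M,
        Q *m P = 1%:M,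
        forall X, X \in S -> P *m X *m Q = \mxdiag_i B i X
      & forall i, irreducible_set (fun Y => exists2 X, X \in S & Y = B i X)].

Definition semisimple_rep d D (sigma : 'I_(d ^ 2 - 1) -> 'M[C]_d)
    (A : tensor R d D) : Prop :=
  semisimple_space (S_span sigma A).

End MPU.

Arguments block {R d D} q A.

(* Main.v *)
(* Write T j j' = \sum_i conj(A i j') (x) A i j for the tensor of U_N^* U_N and
   S(s) = \sum_(j,j') s j j' T j j'.  Unitarity of U_N says that
   tr (S(s_1) ... S(s_N)) = tr s_1 ... tr s_N for N > 1.  In a semisimple
   representation, an element x of the non-unital algebra generated by the S(s)
   with tr (x y) = 0 for every y of that algebra vanishes: such elements form
   an ideal of nilpotent matrices, and an element x of minimal rank on an
   irreducible block satisfies x y x = 0 for all y in the ideal, which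
   contradicts irreducibility.  Hence S(s) = 0 for traceless s and E = S_0 is
   idempotent of trace 1, so T j j' = delta_(j,j') E with E of rank one.
   Comparing the entries, the d x d matrices (A i j a b)_(j,i) with b fixed are
   proportional to each other, so all A i j have the same one-dimensional range
   and traces of products of the A i j factor: blocking is not even needed. *)
From HB Require Import structures.
Require Import Defs.
From mathcomp Require Import all_boot all_order all_algebra.
From mathcomp Require Import sesquilinear spectral.
From mathcomp Require Import all_classical all_reals all_analysis.
From mathcomp Require Import complex mxtens.
From mathcomp Require Import ring.

Set Implicit Arguments.
Unset Strict Implicit.
Unset Printing Implicit Defensive.

Import Order.TTheory GRing.Theory Num.Theory.
Local Open Scope ring_scope.
Local Open Scope complex_scope.

(** * Nilpotency from vanishing traces of powers *)

(** Write [e = V U] through its rank. Cancelling the outer full-rank factors in [e e = e] leaves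
    [U V = 1], of size [\rank e]. *)
Lemma mxtrace_idempotent (F : fieldType) n (e : 'M[F]_n) :
  e *m e = e -> \tr e = (\rank e)%:R.
Proof.
move=> ee; have /row_freeP[U' hU] := row_base_free e.
have /row_fullP[V' hV] := col_base_full e.
move: (mulmx_base e) U' V' hU hV; move: (row_base e) (col_base e).
move: (\rank e) => r U V eE U' V' hU hV.
suff UV : U *m V = 1%:M by rewrite -{1}eE mxtrace_mulC UV mxtrace1.
have := congr1 (fun M => V' *m M *m U') ee; rewrite -eE !mulmxA hV !mul1mx.
by rewrite -!mulmxA hU mulmx1.
Qed.

Lemma mxtrace_horner_mx (F : fieldType) n (M : 'M[F]_n.+1) t (p : {poly F}) :
  (forall k, \tr (M ^+ k.+2) = t) ->
  \tr (horner_mx M (p * 'X^2)) = p.[1] * t.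
Proof.
move=> hM; rewrite -[p]coefK poly_def mulr_suml !linear_sum /=.
rewrite horner_sum mulr_suml; apply: eq_bigr => i _.
rewrite hornerZ hornerXn expr1n mulr1 -scalerAl -exprD !linearZ /=.
by rewrite rmorphXn /= horner_mx_X addn2 hM.
Qed.

(** The projection onto the invertible part of [M] in its Fitting decomposition is a polynomial in
    [M] divisible by ['X^2]. Its trace is therefore 0, and in characteristic 0 so is its rank. *)
Lemma nilpotent_mxtrace (F : numFieldType) n (M : 'M[F]_n) :
  (forall k, \tr (M ^+ k.+2) = 0) -> exists k, M ^+ k = 0.
Proof.
case: n M => [|n] M hM; first by exists 0; exact: flatmx0.
pose chi := char_poly M.
have chi0 : chi != 0 by rewrite monic_neq0 ?char_poly_monic.
have [m [q q0 chiE]] := multiplicity_XsubC chi 0.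
rewrite chi0 /= subr0 in q0 chiE.
(* The exponent [m.+2] instead of [m] keeps all monomials of [e] in degree at least two, where
   traces are known. *)
have /Bezout_eq1_coprimepP[[u v] /= uv] : coprimep 'X^(m.+2) q.
  by rewrite coprimep_expl // coprimep_sym -['X]subr0 -polyC0 coprimep_XsubC.
pose e := horner_mx M (u * 'X^(m.+2)).
have Mq : horner_mx M ('X^(m.+2) * q) = 0.
  rewrite [_ * q]mulrC -addn2 exprD mulrA -chiE rmorphM /=.
  by rewrite /chi Cayley_Hamilton mul0r.
have ee : e *m e = e.
  rewrite /e -[_ *m _]/(_ * _) -rmorphM /= -[in RHS](mulr1 (u * _)) -[in RHS]uv.
  rewrite mulrDr [in RHS]rmorphD /= [X in _ + X](_ : _ = 0) ?addr0 //.
  by rewrite -mulrA [_ * (v * q)]mulrCA 2!rmorphM /= Mq !mulr0.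
have tr0 : \tr e = 0.
  rewrite /e -addn2 exprD mulrA (mxtrace_horner_mx (t := 0)) ?mulr0 //.
have e0 : e = 0.
  have := mxtrace_idempotent ee; rewrite tr0 => /esym/eqP.
  by rewrite pnatr_eq0 mxrank_eq0 => /eqP.
exists m.+2; rewrite -[M]horner_mx_X -rmorphXn /= -['X^_]mulr1 -uv mulrDr.
rewrite rmorphD /= mulrA [_ * u]mulrC -/e rmorphM /= -/e e0 mul0r add0r.
by rewrite mulrCA rmorphM /= Mq mulr0.
Qed.

(** * Block-diagonal products and subspaces given by predicates *)

Lemma mul_mxdiag (F : fieldType) m (p : 'I_m -> nat)
    (A B : forall i, 'M[F]_(p i)) :
  (\mxdiag_i A i) *m (\mxdiag_i B i) = \mxdiag_i (A i *m B i).
Proof.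
rewrite /mxdiag mul_mxdiag_mxblock; apply: eq_mxblock => i j.
case: (eqVneq i j) => [E|_]; last by rewrite mulmx0.
by subst j; rewrite !conform_mx_id.
Qed.

(* Classical: a subset closed under linear combinations has a member subspace
   of maximal dimension, which exhausts it. *)
Lemma vspace_of_linear_closed (F : fieldType) (vT : vectType F)
    (Q : vT -> Prop) :
  Q 0 -> (forall a u v, Q u -> Q v -> Q (a *: u + v)) ->
  exists W : {vspace vT}, forall v, v \in W <-> Q v.
Proof.
move=> Q0 QD.
pose P k :=
  `[< exists W : {vspace vT}, (forall v, v \in W -> Q v) /\ \dim W = k >].
have P0 : exists k, P k.
  exists 0%N; apply/asboolP; exists 0%VS; split; last exact: dimv0.
  by move=> v; rewrite memv0 => /eqP->.
have Pb k : P k -> (k <= \dim {:vT})%N.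
  by move=> /asboolP[W [_ <-]]; apply: dimvS; apply: subvf.
have [k /asboolP[W [WQ Wk]] kmax] := ex_maxnP P0 Pb.
exists W => v; split; first exact: WQ.
move=> Qv; apply: contrapT => /negP vW.
have /kmax : P (\dim (<[v]> + W)%VS).
  apply/asboolP; exists (<[v]> + W)%VS; split => // w.
  by move=> /memv_addP[_ /vlineP[a ->] [u /WQ Qu ->]]; exact: QD.
rewrite leqNgt -Wk => /negP; apply.
rewrite (ltn_leqif (dimv_leqif_sup (addvSr _ _))); apply: contra vW => sW.
by apply: subvP sW _ _; rewrite (subvP (addvSl _ _)) ?memv_line.
Qed.

(* The algebra generated by [S], without unit: in the application the trace of a
   word is only known for words of length at least two. *)
Inductive gen_alg (F : fieldType) n (S : {vspace 'M[F]_n}) : 'M[F]_n -> Prop :=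
| GenAlg X of X \in S : gen_alg S X
| GenAlgD x y of gen_alg S x & gen_alg S y : gen_alg S (x + y)
| GenAlgM X y of X \in S & gen_alg S y : gen_alg S (X *m y).

(** * The radical of the trace form on the generated algebra *)

Section GenAlg.
Variables (F : fieldType) (n : nat) (S : {vspace 'M[F]_n}).

Lemma gen_algM x y : gen_alg S x -> gen_alg S y -> gen_alg S (x *m y).
Proof.
move=> Nx Ny; elim: Nx => {x} [X XS|x1 x2 _ h1 _ h2|X x XS _ h].
- exact: GenAlgM.
- by rewrite mulmxDl; exact: GenAlgD.
- by rewrite -mulmxA; exact: GenAlgM.
Qed.

Lemma gen_algZ a x : gen_alg S x -> gen_alg S (a *: x).
Proof.
elim=> {x} [X XS|x y _ Nx _ Ny|X y XS Ny _].
- by apply: GenAlg; rewrite memvZ.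
- by rewrite scalerDr; exact: GenAlgD.
- by rewrite scalemxAl; apply: GenAlgM; rewrite ?memvZ.
Qed.

Lemma gen_algX x k : gen_alg S x -> gen_alg S (x ^+ k.+1).
Proof.
move=> Nx; elim: k => [|k IH]; first by rewrite expr1.
by rewrite exprS; exact: gen_algM.
Qed.

Definition trace_rad x :=
  gen_alg S x /\ forall y, gen_alg S y -> \tr (x *m y) = 0.

Lemma trace_radMl x y : gen_alg S x -> trace_rad y -> trace_rad (x *m y).
Proof.
move=> Nx [Ny hy]; split; first exact: gen_algM.
move=> z Nz; rewrite -mulmxA mxtrace_mulC -mulmxA; apply: hy; exact: gen_algM.
Qed.

Lemma trace_radMr x y : trace_rad x -> gen_alg S y -> trace_rad (x *m y).
Proof.
move=> [Nx hx] Ny; split; first exact: gen_algM.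
by move=> z Nz; rewrite -mulmxA; apply: hx; exact: gen_algM.
Qed.

Lemma trace_rad0 : trace_rad 0.
Proof.
split; first by apply: GenAlg; rewrite mem0v.
by move=> y _; rewrite mul0mx mxtrace0.
Qed.

Lemma trace_radP a x y : trace_rad x -> trace_rad y -> trace_rad (a *: x + y).
Proof.
move=> [Nx hx] [Ny hy]; split; first by apply: GenAlgD => //; exact: gen_algZ.
move=> z Nz; rewrite mulmxDl -scalemxAl linearD linearZ /= hx // hy //.
by rewrite mulr0 addr0.
Qed.

End GenAlg.

Lemma trace_rad_nilpotent (F : numFieldType) n (S : {vspace 'M[F]_n}) x :
  trace_rad S x -> exists k, x ^+ k = 0.
Proof.
move=> [Nx hx]; apply: nilpotent_mxtrace => k.
by rewrite exprS; apply: hx; exact: gen_algX.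
Qed.

(** If the rank did not drop, the row space of [x] would lie in that of [x y x], so [x = Z x (y x)]
    for some [Z]. Iterating reaches a vanishing power of [y x]. *)
Lemma nilpotent_mxrank_lt (F : fieldType) n (x y : 'M[F]_n) k :
  (y *m x) ^+ k = 0 -> x != 0 -> (\rank (x *m y *m x) < \rank x)%N.
Proof.
move=> nil; rewrite (ltn_leqif (mxrank_leqif_sup (submxMl _ _))).
apply: contra => /submxP[Z hZ].
suff -> : x = Z ^+ k *m x *m (y *m x) ^+ k by rewrite nil mulmx0.
elim: k {nil} => [|k IH]; first by rewrite !expr0 mulmx1 mul1mx.
rewrite exprSr exprS -[_ * _ in X in _ *m X]/(_ *m _) -[Z ^+ k * _]/(_ *m _).
by rewrite {1}IH {1}hZ !mulmxA.
Qed.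

(** * Vanishing of the trace radical on irreducible blocks *)

Section Semisimple.
Variables (R : realType) (n : nat) (S : {vspace 'M[R[i]]_n}).
Local Notation C := (R[i]).
Variables (m : nat) (p : 'I_m -> nat).
Variables (P : 'M[C]_(\sum_i p i, n)) (Q : 'M[C]_(n, \sum_i p i)).
Variables (B : forall i, 'M[C]_n -> 'M[C]_(p i)).
Hypothesis QP : Q *m P = 1%:M.
Hypothesis hB : forall X, X \in S -> P *m X *m Q = \mxdiag_i B i X.

(** [B i] is constrained only on [S]. Reading the block off [P X Q] gives a map that is linear on
    all matrices, and multiplicative on the generated algebra. *)
Let bl i (X : 'M[C]_n) : 'M[C]_(p i) := submxblock (P *m X *m Q) i i.

Lemma bl_mxdiag x (D : forall i, 'M[C]_(p i)) :
  P *m x *m Q = \mxdiag_i D i -> forall i, bl i x = D i.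
Proof. by move=> xD i; rewrite /bl xD submxblock_diag. Qed.

Lemma conj_mulmx x y : P *m (x *m y) *m Q = (P *m x *m Q) *m (P *m y *m Q).
Proof. by rewrite !mulmxA -[_ *m Q *m P]mulmxA QP mulmx1. Qed.

Lemma gen_alg_mxdiag x : gen_alg S x -> P *m x *m Q = \mxdiag_i bl i x.
Proof.
move=> Nx; suff [D xD] : exists D, P *m x *m Q = \mxdiag_i D i.
  by rewrite xD; apply: eq_mxdiag => i; rewrite (bl_mxdiag xD).
elim: Nx => {x} [X XS|x y _ [D1 h1] _ [D2 h2]|X y XS Ny [D hy]].
- by exists (fun i => B i X); exact: hB.
- exists (fun i => D1 i + D2 i).
  by rewrite mulmxDr mulmxDl h1 h2 mxdiagD.
- exists (fun i => B i X *m D i).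
  by rewrite conj_mulmx hB // hy mul_mxdiag.
Qed.

Lemma blM i x y : gen_alg S x -> gen_alg S y ->
  bl i (x *m y) = bl i x *m bl i y.
Proof.
move=> Nx Ny; apply: (bl_mxdiag (D := fun i => bl i x *m bl i y)).
by rewrite conj_mulmx !gen_alg_mxdiag // mul_mxdiag.
Qed.

Lemma bl_gen i X : X \in S -> bl i X = B i X.
Proof. by move=> XS; apply: (bl_mxdiag (D := B^~ X)); exact: hB. Qed.

Lemma bl0 i : bl i 0 = 0.
Proof. by apply/matrixP => u v; rewrite /bl mulmx0 mul0mx !mxE. Qed.

Lemma bl_linear i a x y : bl i (a *: x + y) = a *: bl i x + bl i y.
Proof.
by apply/matrixP => u v; rewrite /bl mulmxDr mulmxDl -scalemxAr -scalemxAl !mxE.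
Qed.

Lemma blX i x k : gen_alg S x -> bl i (x ^+ k.+1) = bl i x ^+ k.+1.
Proof.
move=> Nx; elim: k => [|k IH]; first by rewrite !expr1.
rewrite [in LHS]exprS [in RHS]exprS -IH; apply: blM => //; exact: gen_algX.
Qed.

Lemma bl_nilpotent i x : trace_rad S x -> exists k, bl i x ^+ k = 0.
Proof.
move=> hx; have [k hk] := trace_rad_nilpotent hx; exists k.+1.
rewrite -blX; last exact: hx.1.
by rewrite exprS hk mulr0 bl0.
Qed.

Lemma bl_rad_eq0 i x :
  irreducible_set (fun Y => exists2 X, X \in S & Y = B i X) ->
  trace_rad S x -> bl i x = 0.
Proof.
move=> [_ irr].
have inv (W : {vspace 'cV[C]_(p i)}) :
    (forall X v, X \in S -> v \in W -> bl i X *m v \in W) ->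
    W = 0%VS \/ W = fullv.
  by move=> hW; apply: irr => Y v [X XS ->] vW; rewrite -bl_gen // hW.
(* Strong induction on the rank of the block plays the role of the choice of an element of minimal
   rank. *)
move: {2}(\rank (bl i x)).+1 (ltnSn (\rank (bl i x))) => r.
elim: r x => // r IH x rx Jx; apply: contrapT => /eqP bx0.
have Nx := Jx.1.
have xyx y : trace_rad S y -> bl i x *m bl i y *m bl i x = 0.
  move=> Jy; have Ny := Jy.1.
  rewrite -!blM //; last exact: gen_algM.
  apply: IH; last by apply: trace_radMl => //; exact: gen_algM.
  have [k hk] := bl_nilpotent i (trace_radMl Ny Jx).
  rewrite !blM //; last exact: gen_algM.
  rewrite blM // in hk; exact: leq_trans (nilpotent_mxrank_lt hk bx0) rx.
have [v xv0] : exists v : 'cV_(p i), bl i x *m v != 0.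
  apply: contrapT => /forallNP h; case/eqP: bx0; apply/matrixP => u v.
  have /negP/negPn/eqP/matrixP/(_ u 0) := h (delta_mx v 0).
  by rewrite -colE !mxE.
(* [W] is the orbit of [x v] under the radical and [K] below is the common kernel of the radical.
   Both are invariant because the radical is a two-sided ideal. *)
have [W hW] : exists W : {vspace 'cV[C]_(p i)}, forall w,
    w \in W <-> exists2 y, trace_rad S y & w = bl i y *m (bl i x *m v).
  apply: vspace_of_linear_closed.
    by exists 0; [exact: trace_rad0 | rewrite bl0 mul0mx].
  move=> a _ _ [y Jy ->] [z Jz ->]; exists (a *: y + z).
    exact: trace_radP.
  by rewrite bl_linear mulmxDl scalemxAl.
have [K hK] : exists K : {vspace 'cV[C]_(p i)}, forall w,
    w \in K <-> forall y, trace_rad S y -> bl i y *m w = 0.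
  apply: vspace_of_linear_closed => [y _|a w w' hw hw' y Jy].
    by rewrite mulmx0.
  by rewrite mulmxDr -scalemxAr hw // hw' // scaler0 addr0.
case: (inv W) => [X w XS /hW[y Jy ->]|W0|W1].
- apply/hW; exists (X *m y); first by apply: trace_radMl => //; exact: GenAlg.
  by rewrite blM ?mulmxA //; [exact: GenAlg|exact: Jy.1].
(* [W = 0] puts the nonzero [x v] in [K], so [K] is everything; but then [x] itself kills [v]. *)
- have xvK : bl i x *m v \in K.
    apply/hK => y Jy; apply/eqP; rewrite -memv0 -W0; apply/hW; by exists y.
  case: (inv K) => [X w XS /hK wK|K0|K1].
  + apply/hK => y Jy; rewrite mulmxA -blM; [|exact: Jy.1|exact: GenAlg].
    by apply: wK; apply: trace_radMr => //; exact: GenAlg.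
  + by move: xvK; rewrite K0 memv0 (negPf xv0).
  + have /hK/(_ _ Jx)/eqP : v \in K by rewrite K1 memvf.
    by rewrite (negPf xv0).
(* If [W] is everything then [v = y x v], hence [x v = x y x v = 0]. *)
- have /hW[y Jy vE] : v \in W by rewrite W1 memvf.
  by case/eqP: xv0; rewrite vE !mulmxA xyx // mul0mx.
Qed.

End Semisimple.

Lemma trace_rad_semisimple (R : realType) n (S : {vspace 'M[R[i]]_n}) x :
  semisimple_space S -> trace_rad S x -> x = 0.
Proof.
move=> [m [p [P [Q [B [_ QP hB irr]]]]]] hx.
have xE := gen_alg_mxdiag QP hB hx.1.
rewrite -[x]mulmx1 -QP -[x]mul1mx -QP -!mulmxA.
rewrite [P *m _]mulmxA [P *m x *m _]mulmxA xE.
rewrite (eq_mxdiag (B'_ := fun i => 0)) ?mxdiag0 ?mul0mx ?mulmx0 // => i.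
exact: bl_rad_eq0 (irr i) hx.
Qed.

(** * Products of sums, of tensor products and of rank-one matrices *)

(** Commutativity is not assumed, so that this serves for products of matrices as well as of
    scalars. *)
Lemma prod_sum_site (K : pzRingType) d N (F : 'I_N -> 'I_d -> K) :
  \prod_k \sum_j F k j = \sum_(x : 'I_(hdim d N)) \prod_k F k (site x k).
Proof.
rewrite bigA_distr_bigA.
rewrite (reindex (fun x : 'I_(hdim d N) => [ffun k => site x k])) /=.
  by apply: eq_bigr => x _; apply: eq_bigr => k _; rewrite ffunE.
exists (fun f : {ffun 'I_N -> 'I_d} => enum_rank [tuple f k | k < N]) => [x|f] _.
  rewrite -[RHS]enum_valK; congr enum_rank.
  by apply: eq_from_tnth => k; rewrite tnth_mktuple ffunE.
by apply/ffunP => k; rewrite ffunE /site enum_rankK tnth_mktuple.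
Qed.

Lemma mxtrace_tens (K : comPzRingType) m n (M : 'M[K]_m) (M' : 'M[K]_n) :
  \tr (M *t M') = \tr M * \tr M'.
Proof.
rewrite /mxtrace (mulr_sum (fun i => M i i)); apply: eq_bigr => k _.
by case: (mxtens_indexP k) => i j; rewrite tensmxE mxtens_indexK.
Qed.

Lemma tens_mx1 (K : comPzRingType) m n : 1%:M *t 1%:M = 1%:M :> 'M[K]_(m * n).
Proof.
apply/matrixP => k l; case: (mxtens_indexP k) => i j.
case: (mxtens_indexP l) => i' j'.
by rewrite tensmxE !mxE (can_eq (@mxtens_indexK _ _)) -natrM mulnb.
Qed.

Lemma prod_tens (K : comPzRingType) m n N (F : 'I_N -> 'M[K]_m)
    (G : 'I_N -> 'M[K]_n) :
  \prod_k (F k *t G k) =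
  (\big[mulmx/1%:M]_k F k) *t (\big[mulmx/1%:M]_k G k).
Proof.
elim/big_rec3: _ => [|k x y z _ ->]; first by rewrite tens_mx1.
exact: tensmx_mul.
Qed.

Lemma prod_scale_mx (K : comPzRingType) n N (a : 'I_N -> K)
    (F : 'I_N -> 'M[K]_n) :
  \prod_k (a k *: F k) = (\prod_k a k) *: \prod_k F k.
Proof.
elim/big_rec3: _ => [|k x y z _ ->]; first by rewrite scale1r.
by rewrite -[_ * _ in LHS]/(_ *m _) -scalemxAl -scalemxAr scalerA.
Qed.

(** [y] is an eigenvector of each factor, with the trace of that factor as eigenvalue. The product
    must be nonempty: an empty one has trace [n]. *)
Lemma mxtrace_prod_rank1 (K : comPzRingType) n N (y : 'cV[K]_n)
    (w : 'I_N.+1 -> 'rV[K]_n) :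
  \tr (\big[mulmx/1%:M]_k (y *m w k)) = \prod_k \tr (y *m w k).
Proof.
have wy (u : 'rV[K]_n) : u *m y = (\tr (y *m u))%:M.
  by rewrite mxtrace_mulC trace_mx11 -mx11_scalar.
rewrite -[\big[mulmx/_]_k _]/(\prod_k (y *m w k : 'M[K]_n)).
rewrite !big_ord_recr /= -[X in \tr X]/(_ *m _) mulmxA.
set M := \prod_(_ < N) _ ; set c := \prod_(_ < N) _.
suff -> : M *m y = c *: y by rewrite -scalemxAl mxtraceZ.
rewrite /M /c; elim/big_rec2: _ => [|k u v _ IH]; first by rewrite mul1mx scale1r.
rewrite -[_ * v]/(_ *m v) -!mulmxA IH -!scalemxAr wy mul_mx_scalar scalerA.
by rewrite mulrC.
Qed.

(** * A common range for all matrices of the tensor *)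

Section Factor.
Variables (C : numClosedFieldType) (d D : nat) (A : 'I_d -> 'I_d -> 'M[C]_D).
(** The column and row factors of the rank-one matrix [E], with each index of the doubled bond space
    split into a pair. *)
Variables (c r : 'I_D -> 'I_D -> C).
Hypothesis hA : forall j j' a' a b' b,
  \sum_i Num.conj (A i j' a' b') * A i j a b = (j == j')%:R * (c a' a * r b' b).

Lemma tensor_rank1 a0' a0 b0' b0 : c a0' a0 != 0 -> r b0' b0 != 0 ->
  exists (y : 'cV[C]_D) (w : 'I_d -> 'I_d -> 'rV[C]_D),
    forall i j, A i j = y *m w i j.
Proof.
move=> c0 r0; pose g a := c a0' a / c a0' a0.
pose N a : 'M[C]_d := \matrix_(j, i) A i j a b0.
pose N' a' : 'M[C]_d := \matrix_(i, j') Num.conj (A i j' a' b0').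
have NN' a a' : N a *m N' a' = (c a' a * r b0' b0)%:M.
  apply/matrixP => j j'; rewrite !mxE -mulr_natl -hA.
  by apply: eq_bigr => i _; rewrite !mxE mulrC.
have N'u : N' a0' \in unitmx.
  have := NN' a0 a0' => /(congr1 (fun M => (c a0' a0 * r b0' b0)^-1 *: M)).
  rewrite scalemxAl -[in RHS]mul_scalar_mx -scalar_mxM mulVf ?mulf_neq0 //.
  by move=> /mulmx1_unit[].
(* Both [N a] and [N a0] become scalar matrices after multiplication by the invertible [N' a0'], and
   [g a] is the ratio of the scalars. *)
have Ng a : N a = g a *: N a0.
  apply: (can_inj (mulmxK N'u)); rewrite -scalemxAl !NN' -mul_scalar_mx.
  by rewrite -scalar_mxM /g mulrA divfK.
have Ab0 i j a : A i j a b0 = g a * A i j a0 b0.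
  by have /matrixP/(_ j i) := Ng a; rewrite !mxE.
exists (\col_a g a), (fun i j => row a0 (A i j)) => i j.
have cg a' a : c a' a = g a * c a' a0.
  apply: (mulIf r0); rewrite -mulrA -[LHS]mul1r -[_ * r _ _ in RHS]mul1r.
  rewrite -[1]/(true%:R) -(eqxx j) -!hA mulr_sumr; apply: eq_bigr => k _.
  by rewrite Ab0 mulrCA.
(* Proportionality is known only in column [b0]; [r] may vanish at other columns. There [z], the
   deviation from it, has squared norm 0 by [hA] and [cg]. *)
apply/matrixP => a b; rewrite !mxE big_ord1 !mxE.
pose z k := A k j a b - g a * A k j a0 b.
suff : z i == 0 by rewrite subr_eq0 => /eqP.
have : \sum_k Num.conj (z k) * z k = 0.
  transitivity ((\sum_k Num.conj (A k j a b) * A k j a b)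
    - g a * (\sum_k Num.conj (A k j a b) * A k j a0 b)
    - Num.conj (g a) * (\sum_k Num.conj (A k j a0 b) * A k j a b)
    + Num.conj (g a) * g a * (\sum_k Num.conj (A k j a0 b) * A k j a0 b)).
    rewrite !mulr_sumr -!sumrB -big_split; apply: eq_bigr => k _ /=.
    rewrite /z rmorphB rmorphM /=.
    set p := A k j a b; set q := A k j a0 b.
    by ring.
  rewrite !hA eqxx !mul1r (cg a a) (cg a0 a); ring.
move=> /psumr_eq0P/(_ i isT) z0.
have {}z0 : Num.conj (z i) * z i = 0.
  by apply: z0 => k _; rewrite mulrC mul_conjC_ge0.
by move/eqP: z0; rewrite mulf_eq0 conjC_eq0 orbb.
Qed.

End Factor.

(** * Unitarity as a formula for traces of words *)

Section SemisimpleMPU.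
Variables (R : realType) (d D : nat) (A : tensor R d D).
Local Notation C := (R[i]).

Lemma S_sigma_is_linear : linear (S_sigma A).
Proof.
move=> a s t; rewrite /S_sigma scaler_sumr -big_split; apply: eq_bigr => i _ /=.
rewrite scaler_sumr -big_split; apply: eq_bigr => j _ /=.
rewrite scaler_sumr -big_split; apply: eq_bigr => j' _ /=.
by rewrite !mxE scalerDl scalerA.
Qed.

HB.instance Definition _ :=
  GRing.isLinear.Build C 'M[C]_d 'M[C]_(D * D) *:%R (S_sigma A)
    S_sigma_is_linear.

(* The tensor of the MPO [U_N^* U_N]. *)
Definition double_tensor (j j' : 'I_d) : 'M[C]_(D * D) :=
  \sum_i conjmat (A i j') *t A i j.

Lemma S_sigmaE s :
  S_sigma A s = \sum_j \sum_j' s j j' *: double_tensor j j'.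
Proof.
rewrite /S_sigma exchange_big; apply: eq_bigr => j _ /=.
rewrite exchange_big; apply: eq_bigr => j' _ /=.
by rewrite scaler_sumr.
Qed.

Lemma S_sigma_delta j j' : S_sigma A (delta_mx j j') = double_tensor j j'.
Proof.
rewrite S_sigmaE (bigD1 j) //= (bigD1 j') //= !mxE !eqxx scale1r.
rewrite big1 ?addr0 => [|k kj]; last by rewrite !mxE (negPf kj) andbF scale0r.
rewrite big1 ?addr0 // => k kj; rewrite big1 // => l _.
by rewrite !mxE (negPf kj) scale0r.
Qed.

(** Evaluating at the maximally mixed state makes all generators of [S_span] values of one linear
    map. *)
Lemma S_zeroE : S_zero A = S_sigma A (d%:R^-1)%:M.
Proof.
rewrite S_sigmaE /S_zero exchange_big scaler_sumr; apply: eq_bigr => j _ /=.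
rewrite [RHS](bigD1 j) //= [X in _ = _ + X]big1 => [|k kj].
  by rewrite addr0 mxE eqxx mulr1n.
by rewrite !mxE eq_sym (negPf kj) scale0r.
Qed.

(** The contracted physical indices of all sites gather into the multi-index summed in [U_N^* U_N];
    the trace of each tensor product then splits into two entries. *)
Lemma mxtrace_prod_double N (x y : 'I_(hdim d N)) :
  \tr (\prod_k double_tensor (site x k) (site y k)) =
  ((map_mx Num.conj (mpo A 1%:M N))^T *m mpo A 1%:M N) y x.
Proof.
rewrite (prod_sum_site (fun k i => conjmat (A i (site y k)) *t A i (site x k))).
rewrite raddf_sum /= mxE; apply: eq_bigr => z _.
rewrite prod_tens mxtrace_tens !mxE !mul1mx; congr (_ * _).
rewrite -trace_map_mx; congr (\tr _).
by apply/esym; apply: (big_morph (fun M : 'M[C]_D => map_mx Num.conj M));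
  [move=> M M'; exact: map_mxM | exact: map_mx1].
Qed.

(** Expanding in [double_tensor] produces the entries of [U_N^* U_N = 1]. Only equal multi-indices
    survive, and they sum to the product of the traces. *)
Lemma mxtrace_prod_S_sigma N (s : 'I_N -> 'M[C]_d) :
  mpo A 1%:M N \is unitarymx ->
  \tr (\prod_k S_sigma A (s k)) = \prod_k \tr (s k).
Proof.
move=> /unitarymxP/mulmx1C U1.
under eq_bigr do rewrite S_sigmaE.
rewrite (prod_sum_site (fun k j => \sum_j' s k j j' *: double_tensor j j')).
rewrite raddf_sum /= [RHS]prod_sum_site; apply: eq_bigr => x _.
rewrite (prod_sum_site (fun k j' => s k (site x k) j' *: double_tensor (site x k) j')).
rewrite raddf_sum /= (bigD1 x) //= [X in _ + X]big1 ?addr0 => [|y yx];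
  rewrite prod_scale_mx mxtraceZ mxtrace_prod_double map_trmx U1 !mxE.
  by rewrite eqxx mulr1.
by rewrite (negPf yx) mulr0.
Qed.

Hypothesis hd : (0 < d)%N.
Hypothesis hA : forall N : nat, (1 < N)%N -> mpo A 1%:M N \is unitarymx.

Lemma mxtrace_max_mixed : \tr ((d%:R^-1)%:M : 'M[C]_d) = 1.
Proof. by rewrite mxtrace_scalar -[LHS]mulr_natr mulVf // pnatr_eq0 -lt0n. Qed.

Definition word (ss : seq 'M[C]_d) : 'M[C]_(D * D) :=
  \prod_(s <- ss) S_sigma A s.

Lemma mxtrace_word ss :
  (1 < size ss)%N -> \tr (word ss) = \prod_(s <- ss) \tr s.
Proof.
move=> h; rewrite /word (big_nth 0) big_mkord [RHS](big_nth 0) big_mkord.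
exact: (mxtrace_prod_S_sigma (fun k => ss`_k) (hA h)).
Qed.

Lemma word_cat ss ss' : word (ss ++ ss') = word ss *m word ss'.
Proof. exact: big_cat. Qed.

Lemma word1 s : word [:: s] = S_sigma A s.
Proof. exact: big_seq1. Qed.

Lemma word_nseq k s : word (nseq k s) = S_sigma A s ^+ k.
Proof. by rewrite /word big_nseq iter_mulr_1. Qed.

(** * Consequences of semisimplicity: [E] has rank one *)

Section Span.
Variables (sigma : 'I_(d ^ 2 - 1) -> 'M[C]_d).
Hypothesis hsigma : hermitian_traceless_basis sigma.

(** Orthonormality makes [sigma] free, the trace separates the scalar matrix from it, and
    [1 + (d ^ 2 - 1)] is the full dimension because [d > 0]. *)
Lemma span_hermitian_traceless :
  <<(d%:R^-1)%:M :: [seq sigma a | a : 'I_(d ^ 2 - 1)]>>%VS = fullv.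
Proof.
have [_ tr0 orth] := hsigma.
pose X := [tuple sigma a | a < d ^ 2 - 1].
have XE : [seq sigma a | a : 'I_(d ^ 2 - 1)] = X by [].
have nthX (a : 'I_(d ^ 2 - 1)) : X`_a = sigma a by rewrite -tnth_nth tnth_mktuple.
have freeX : free X.
  apply/freeP => k /(congr1 (fun M => fun a => \tr (M *m sigma a))) k0 a.
  have := congr1 (fun f => f a) k0; rewrite mul0mx mxtrace0 mulmx_suml raddf_sum /=.
  rewrite (bigD1 a) //= big1 ?addr0 => [|b ba];
    rewrite nthX -scalemxAl mxtraceZ orth ?eqxx ?mulr1 //.
  by rewrite (negPf ba) mulr0.
have free1X : free ((d%:R^-1)%:M :: X).
  rewrite free_cons freeX andbT; apply/negP => /coord_span.
  move=> /(congr1 mxtrace); rewrite mxtrace_max_mixed raddf_sum /= big1 => [|a _].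
    by move/eqP; rewrite oner_eq0.
  by rewrite mxtraceZ nthX tr0 mulr0.
rewrite XE; apply/eqP; rewrite eqEdim subvf /=.
have := free1X; rewrite /free => /eqP ->.
rewrite /= size_tuple card_ord dimvf /dim /= -addn1 subnK ?expn_gt0 ?hd //.
Qed.

Lemma memv_S_span X : X \in S_span sigma A <-> exists s, X = S_sigma A s.
Proof.
have -> : S_span sigma A = (linfun (S_sigma A) @: fullv)%VS.
  rewrite -span_hermitian_traceless limg_span /S_span /= lfunE /= -S_zeroE.
  congr (<< _ :: _ >>)%VS; rewrite -map_comp; apply: eq_map => a /=.
  by rewrite lfunE.
split=> [/memv_imgP[s _ ->]|[s ->]]; first by exists s; rewrite lfunE.
by apply/memv_imgP; exists s; rewrite ?memvf // lfunE.
Qed.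

Hypothesis hss : semisimple_rep sigma A.

Lemma S_sigma_traceless s : \tr s = 0 -> S_sigma A s = 0.
Proof.
move=> s0; apply: (trace_rad_semisimple hss); split.
  by apply: GenAlg; apply/memv_S_span; exists s.
(* The suffix [ss] absorbs the letters that the induction on [y] peels off, while the traceless [s]
   stays in the word. *)
suff H y : gen_alg (S_span sigma A) y ->
    forall ss, \prod_(s <- s :: ss) \tr s = 0 -> \tr (word (s :: ss) *m y) = 0.
  by move=> y /H/(_ [::]); rewrite word1; apply; rewrite big_seq1.
elim=> {y} [X /memv_S_span[t ->]|y z _ hy _ hz|X y /memv_S_span[t ->] _ IH] ss ss0.
- by rewrite -word1 -word_cat mxtrace_word ?size_cat ?addn1 // big_cat /= ss0 mul0r.
- by rewrite mulmxDr mxtraceD hy // hz // addr0.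
- rewrite mulmxA -(word1 t) -word_cat cat_cons IH // -cat_cons.
  by rewrite big_cat /= ss0 mul0r.
Qed.

Let E := S_sigma A (d%:R^-1)%:M.

Lemma S_sigma_trace s : S_sigma A s = \tr s *: E.
Proof.
apply/eqP; rewrite -subr_eq0.
rewrite (_ : _ - _ = S_sigma A (s - \tr s *: (d%:R^-1)%:M)); last first.
  by rewrite linearB [in RHS]linearZ.
apply/eqP/S_sigma_traceless.
by rewrite linearB linearZ /= mxtrace_max_mixed mulr1 subrr.
Qed.

Lemma mxtrace_exp_S_zero k : \tr (E ^+ k.+2) = 1.
Proof.
rewrite -word_nseq mxtrace_word ?size_nseq // big_nseq iter_mulr_1.
by rewrite mxtrace_max_mixed expr1n.
Qed.

(** [E E - E] lies in the trace radical: by [S_sigma_trace] every letter is a multiple of [E], and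
    all powers of [E] from the second on have trace 1. *)
Lemma S_zero_idempotent : E *m E = E.
Proof.
have Er k : E ^+ k *m E = E ^+ k.+1 by rewrite exprSr.
have ES : E \in S_span sigma A by apply/memv_S_span; eexists.
apply/eqP; rewrite -subr_eq0; apply/eqP.
apply: (trace_rad_semisimple hss); split.
  apply: GenAlgD; last by apply: GenAlg; rewrite memvN.
  by apply: GenAlgM => //; exact: GenAlg.
(* The power [E ^+ k.+1] and the one letter or more in [y] make words of length at least two, as the
   trace formula requires. *)
suff H y : gen_alg (S_span sigma A) y ->
    forall k, \tr (E ^+ k.+2 *m y) = \tr (E ^+ k.+1 *m y).
  by move=> y /H/(_ 0%N); rewrite mulmxBl linearB /= expr1 expr2 => ->; rewrite subrr.
elim=> {y} [X /memv_S_span[t ->]|y z _ hy _ hz|X y /memv_S_span[t ->] _ IH] k.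
- by rewrite S_sigma_trace -!scalemxAr !mxtraceZ !Er !mxtrace_exp_S_zero.
- by rewrite !mulmxDr !mxtraceD hy // hz.
- by rewrite S_sigma_trace -!scalemxAl -!scalemxAr !mxtraceZ !mulmxA !Er IH.
Qed.

Lemma double_tensorE j j' : double_tensor j j' = (j == j')%:R *: E.
Proof.
rewrite -S_sigma_delta S_sigma_trace; congr (_ *: _).
rewrite /mxtrace (bigD1 j) //= big1 ?addr0 => [|k kj]; rewrite mxE ?eqxx //.
by rewrite (negPf kj).
Qed.

(** Unitarity says nothing about a word of length one; idempotency turns [E] into a word of length
    two. *)
Lemma mxtrace_S_zero : \tr E = 1.
Proof. by rewrite -S_zero_idempotent -[_ *m _]expr2 mxtrace_exp_S_zero. Qed.

Lemma S_zero_rank1 :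
  exists (u : 'cV[C]_(D * D)) (v : 'rV[C]_(D * D)), E = u *m v.
Proof.
have := mxtrace_idempotent S_zero_idempotent; rewrite mxtrace_S_zero => /esym/eqP.
rewrite pnatr_eq1 => /eqP E1; rewrite -[E]mulmx_base.
by move: (col_base E) (row_base E); rewrite E1 => u v; exists u, v.
Qed.

Lemma semisimple_mpu_rank1 :
  exists (y : 'cV[C]_D) (w : 'I_d -> 'I_d -> 'rV[C]_D),
  forall i j, A i j = y *m w i j.
Proof.
have [u [v Euv]] := S_zero_rank1.
have : E != 0.
  apply/eqP => E0; have /eqP := mxtrace_S_zero.
  by rewrite E0 mxtrace0 eq_sym oner_eq0.
move=> /matrix0Pn[k [l]]; rewrite Euv mxE big_ord1 mulf_eq0 negb_or => /andP[].
(* A nonzero entry of [E] supplies the indices at which [c] and [r] are nonzero. *)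
case: (mxtens_indexP k) => a0' a0; case: (mxtens_indexP l) => b0' b0.
apply: (tensor_rank1 (c := fun a' a => u (mxtens_index (a', a)) 0)
  (r := fun b' b => v 0 (mxtens_index (b', b)))) => j j' a' a b' b.
have /matrixP/(_ (mxtens_index (a', a)) (mxtens_index (b', b))) := double_tensorE j j'.
rewrite Euv !mxE big_ord1 => <-; rewrite summxE; apply: eq_bigr => i _.
by rewrite tensmxE !mxE.
Qed.

(** Unitarity is assumed only for [N > 1]. For one site it follows from [double_tensorE] and
    [\tr E = 1]. *)
Lemma semisimple_mpu_unitary1 : mpo A 1%:M 1 \is unitarymx.
Proof.
apply/unitarymxP/mulmx1C/matrixP => y x.
rewrite -map_trmx -mxtrace_prod_double big_ord1 double_tensorE mxtraceZ.
rewrite mxtrace_S_zero mulr1 mxE; congr (_%:R); congr nat_of_bool.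
apply/eqP/eqP => [xy|->//]; apply: enum_val_inj; apply: eq_from_tnth => k.
by rewrite (ord1 k) -[tnth _ _]/(site y 0) -xy.
Qed.

End Span.
End SemisimpleMPU.

(** * Factorization of the MPU *)

Lemma blockE1 (R : realType) d D (A : tensor R d D) x y :
  block 1 A x y = A (site x 0) (site y 0).
Proof. exact: (@big_ord1 _ (1 : 'M[R[i]]_D) *%R). Qed.

Theorem corollary19 (R : realType) (d D : nat) (hd : (0 < d)%N) (hD : (0 < D)%N)
    (sigma : 'I_(d ^ 2 - 1) -> 'M[R[i]]_d)
    (hsigma : hermitian_traceless_basis sigma)
    (A : tensor R d D)
    (hA : forall N : nat, (1 < N)%N -> mpo A 1%:M N \is unitarymx)
    (hss : semisimple_rep sigma A) :
  exists (q : nat) (V : 'M[R[i]]_(hdim d q)) (theta : R),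
    [/\ (0 < q)%N,
        V \is unitarymx
      & forall N : nat, (0 < N)%N ->
          mpo (block q A) 1%:M N = expi (theta * N%:R) *: tensor_power V N].
Proof.
(* Blocks of one site suffice, and [V = U_1] already carries any phase, so [theta = 0]. *)
exists 1%N, (mpo A 1%:M 1), 0; split => //.
  exact: (semisimple_mpu_unitary1 hd hA hsigma hss).
have [y [w AE]] := semisimple_mpu_rank1 hd hA hsigma hss.
case=> // N _; rewrite mul0r /expi cos0 sin0 scale1r.
apply/matrixP => a b; rewrite !mxE mul1mx.
(* The outer [site _ 0] reads the single original site inside the block selected by [site a k]. *)
pose w' (k : 'I_N.+1) := w (site (site a k) 0) (site (site b k) 0).
transitivity (\tr (\big[mulmx/1%:M]_k (y *m w' k))).
  by congr (\tr _); apply: eq_bigr => k _; rewrite blockE1 AE.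
rewrite mxtrace_prod_rank1; apply: eq_bigr => k _.
by rewrite mxE mul1mx -[\big[_/_]_k _]/(block 1 A _ _) blockE1 AE.
Qed.
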